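(* For each integer $k\geq 4$ there exists a simple non-Hamiltonian $k$-regular graph $Y$ whose line graph $L(Y)$ has a Hamilton decomposition.
   Context: The line graph $L(Y)$ has the edges of $Y$ as vertices, two adjacent when they share an endpoint. If a graph is regular of degree $2m$ or $2m+1$, a Hamilton decomposition of it is a set of $m$ pairwise edge-disjoint Hamilton cycles. *)

(* Defs.v *)
From mathcomp Require Import all_boot.

Set Implicit Arguments.
Unset Strict Implicit.
Unset Printing Implicit Defensive.

(* The vertex set may be empty, because the line graph of an edgeless graph has
   no vertices. Statements about a graph in the usual sense therefore have to
   ask for a vertex explicitly. *)
Record sgraph : Type := SGraph {
  vertex :> finType;
  adj : rel vertex;
  adj_sym : symmetric adj;
  adj_irrefl : irreflexive adj
}.

Definition regular (G : sgraph) (d : nat) : Prop :=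
  forall x : G, #|[set y | adj x y]| = d.

Definition edges (G : sgraph) : {set {set G}} :=
  [set e | [exists x, exists y, adj x y && (e == [set x; y])]].

Definition edge (G : sgraph) : finType := {e : {set G} | e \in edges G}.

Definition share_endpoint (G : sgraph) : rel (edge G) :=
  fun e f => (e != f) && (val e :&: val f != set0).

Lemma share_endpoint_sym (G : sgraph) : symmetric (@share_endpoint G).
Proof. by move=> e f; rewrite /share_endpoint eq_sym setIC. Qed.

Lemma share_endpoint_irrefl (G : sgraph) : irreflexive (@share_endpoint G).
Proof. by move=> e; rewrite /share_endpoint eqxx. Qed.

Definition line_graph (G : sgraph) : sgraph :=
  SGraph (@share_endpoint_sym G) (@share_endpoint_irrefl G).

Definition cycle_edges (G : sgraph) (s : seq G) : {set {set G}} :=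
  [set [set x; next s x] | x in s].

(* A Hamilton cycle is identified with its set of edges, so that the choice of
   starting point and direction is irrelevant. The bound on the size excludes
   the degenerate closed walks x and x, y. *)
Definition hamilton_cycle (G : sgraph) (C : {set {set G}}) : Prop :=
  exists s : seq G, [/\ 2 < size s, ucycle (@adj G) s,
    forall x : G, x \in s & C = cycle_edges s].

Definition hamiltonian (G : sgraph) : Prop :=
  exists C : {set {set G}}, hamilton_cycle C.

(* The number m is determined by G as soon as G has a vertex. *)
Definition hamilton_decomposition (G : sgraph) (D : {set {set {set G}}}) :
    Prop :=
  exists m : nat, [/\ regular G (2 * m) \/ regular G (2 * m + 1),
    #|D| = m,
    forall C, C \in D -> hamilton_cycle C &
    forall C C', C \in D -> C' \in D -> C != C' -> [disjoint C & C']].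

(* Main.v *)
(* Give the edges of a bipartite k-regular graph a proper edge colouring by an
   index set I of size k, and call the two sides A and B. If the edges of the
   complete graph on I are split into k - 1 classes, with class c used at the A
   vertices and class c + 1 used at the B vertices, then each c selects a
   2-regular spanning subgraph of the line graph, and these subgraphs partition
   its edges. With I = Z_(k-1) + {None} and classes given by the sum of the two
   indices (twice the index, for a pair with None), the union of classes c and
   c + 1 is a zigzag Hamilton cycle on I, so the components of the selected
   subgraph are the cycles of a permutation of the edges that follows this cycle
   of indices over and over.

   The graph consists of an edge uv and k - 1 gadgets, each of them the bipartite
   graph on two copies of Z_n with edges x -> x + g_i, in which one edge of index
   a (for gadget a) is cut and its ends are joined to v and u. Removing u and v
   leaves k - 1 > 2 components, so the graph is not Hamiltonian. Going once around
   the index cycle of colour c moves a gadget vertex by a signed sum of the g_i;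
   exactly one g_i is odd and n is a power of 2, so this sum generates Z_n and
   each uncut gadget is traversed by a single cycle. Cutting it open and inserting
   it at u and v merges it with the cycle through u and v. *)

Require Import Defs.
From mathcomp Require Import all_boot all_fingroup all_algebra zify ring.

Set Implicit Arguments.
Unset Strict Implicit.
Unset Printing Implicit Defensive.

Lemma set2_eqP (T : finType) (x y x' y' : T) :
  x != y -> [set x; y] = [set x'; y'] -> (x = x' /\ y = y') \/ (x = y' /\ y = x').
Proof.
move=> xy exy; have xE : x \in [set x'; y'] by rewrite -exy set21.
have yE : y \in [set x'; y'] by rewrite -exy set22.
case/set2P: xE yE xy => -> /set2P[] ->; rewrite ?eqxx //; by [left | right].
Qed.

(** * Graphs with a one-factorization and their line graphs *)

Section OneFactorization.

Variables (V I : finType) (far : I -> V -> V).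
Hypothesis far_inv : forall i, involutive (far i).
Hypothesis far_neq : forall i u, far i u != u.
Hypothesis far_inj : forall u, injective (far^~ u).

Definition far_adj : rel V := fun u v => [exists i, v == far i u].

Lemma far_adj_sym : symmetric far_adj.
Proof.
by move=> u v; apply/existsP/existsP => -[i /eqP->]; exists i; rewrite far_inv.
Qed.

Lemma far_adj_irrefl : irreflexive far_adj.
Proof. by move=> u; apply/existsP => -[i]; rewrite eq_sym (negPf (far_neq i u)). Qed.

Definition far_graph : sgraph := SGraph far_adj_sym far_adj_irrefl.

Lemma far_graph_regular : regular far_graph #|I|.
Proof.
move=> u; rewrite -(card_imset _ (@far_inj u)); apply: eq_card => v.
rewrite inE; apply/existsP/imsetP => [[i /eqP->]|[i _ ->]]; by exists i.
Qed.

Lemma far_edge_in i u : [set u; far i u] \in edges far_graph.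
Proof.
rewrite inE; apply/existsP; exists u; apply/existsP; exists (far i u).
by rewrite eqxx andbT; apply/existsP; exists i.
Qed.

Definition far_edge i u : edge far_graph := Sub [set u; far i u] (far_edge_in i u).

Lemma far_edge_far i u : far_edge i (far i u) = far_edge i u.
Proof. by apply: val_inj; rewrite /= far_inv setUC. Qed.

Lemma far_edgeP (e : edge far_graph) : exists i u, e = far_edge i u.
Proof.
have := valP e; rewrite inE.
case/existsP=> u /existsP[v] /andP[/existsP[i /eqP->]] /eqP e_def.
by exists i, u; apply: val_inj.
Qed.

Lemma far_edge_at i u v : v \in val (far_edge i u) -> far_edge i u = far_edge i v.
Proof. by case/set2P=> ->; rewrite ?far_edge_far. Qed.

Lemma far_edge_inj u : injective (far_edge^~ u).
Proof.
move=> i j /(congr1 val)/= /setP/(_ (far i u)).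
rewrite !inE eqxx orbT (negPf (far_neq i u)) /= => /esym/eqP; exact: far_inj.
Qed.

Lemma far_edge_meet i j u : i != j ->
  val (far_edge i u) :&: val (far_edge j u) = [set u].
Proof.
move=> ij; apply/setP=> v; rewrite !inE; have [//|/= vu] := eqVneq v u.
apply/negP=> /andP[/eqP-> /eqP/far_inj eij]; by rewrite eij eqxx in ij.
Qed.

Lemma far_edge_adj i j u :
  @adj (line_graph far_graph) (far_edge i u) (far_edge j u) = (i != j).
Proof.
rewrite /= /share_endpoint (inj_eq (@far_edge_inj u)).
have [//|ij] := eqVneq i j; rewrite far_edge_meet //=.
by apply/set0Pn; exists u; rewrite inE.
Qed.

(** Each end of an edge contributes one neighbour for every other index. None is counted from both
    ends: by [far_inj] there are no parallel edges. *)
Lemma line_far_graph_regular : regular (line_graph far_graph) (2 * #|I|.-1).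
Proof.
move=> e; have [i [u ->]] := far_edgeP e.
pose nb (t : bool * I) := far_edge t.2 (if t.1 then far i u else u).
have nb_inj : {in setX setT [set~ i] &, injective nb}.
  have side j l b : j != i -> l != i -> nb (b, j) = nb (~~ b, l) -> False.
    move=> ji li; rewrite {}/nb /= => jl.
    set v := if b then _ else _ in jl; set w := if ~~ b then _ else _ in jl.
    have wv : w = far i v by rewrite /w /v; case: (b); rewrite ?far_inv.
    have : w \in val (far_edge j v) by rewrite jl /= set21.
    rewrite wv !inE (negPf (far_neq i v)) /= => /eqP/far_inj ij.
    by rewrite ij eqxx in ji.
  move=> [b j] [b' l]; rewrite !inE /= => ji li.
  have [<-{b'}|] := eqVneq b b'; first by move=> /far_edge_inj /= ->.
  by case: b b' => -[] // _ /side [].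
transitivity #|nb @: setX setT [set~ i]|; last first.
  by rewrite card_in_imset // cardsX cardsT card_bool cardsC1.
apply: eq_card => f; rewrite inE; apply/idP/imsetP => [|[[b j]]].
- case/andP=> ef /set0Pn[v]; rewrite inE => /andP[ve vf].
  have [j [w fE]] := far_edgeP f; move: vf ef; rewrite {f}fE => /far_edge_at->.
  case/set2P: ve => -> ef.
    exists (false, j) => //; rewrite !inE /=.
    by apply: contraNneq ef => ->.
  exists (true, j) => //; rewrite !inE /=.
  by apply: contraNneq ef => ->; rewrite far_edge_far.
- rewrite !inE /= => ji ->; rewrite /nb /= eq_sym in ji *.
  case: b; last exact: etrans (far_edge_adj i j u) ji.
  by rewrite -(far_edge_far i u); apply: etrans (far_edge_adj _ _ _) ji.
Qed.

(* [kap u i j] is the colour of the pair of edges at [u] with indices [i] and [j];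
   each such pair is an edge of the line graph, and lies at a single [u]. *)
Lemma far_graph_decomposition (C : finType) (kap : V -> I -> I -> C) :
    #|C| = #|I|.-1 -> (forall u i j, kap u i j = kap u j i) ->
    (forall c, exists s : seq (edge far_graph),
       [/\ 2 < size s, ucycle (@adj (line_graph far_graph)) s, forall e, e \in s
         & {in s, forall e, exists u i j,
             [/\ i != j, e = far_edge i u, next s e = far_edge j u
               & kap u i j = c]}]) ->
  exists D : {set {set {set line_graph far_graph}}}, hamilton_decomposition D.
Proof.
move=> cardC kapC /fin_all_exists[s sP].
pose H c : {set {set line_graph far_graph}} := @cycle_edges (line_graph far_graph) (s c).
have HP c x : x \in H c -> exists u i j,
    [/\ i != j, x = [set far_edge i u; far_edge j u] & kap u i j = c].
  case/imsetP=> e es ->; have [_ _ _ /(_ e es)[u [i [j [ij eE -> <-]]]]] := sP c.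
  by exists u, i, j; rewrite eE.
(* The two edges in [x] meet in a single vertex, so [x] determines that vertex and the index pair up
   to order, hence its colour. *)
have H_color c d x : x \in H c -> x \in H d -> c = d.
  case/HP=> u [i [j [ij -> <-]]] /HP[v [i' [j' [ij' eE <-]]]].
  have ef : far_edge i u != far_edge j u by rewrite (inj_eq (@far_edge_inj u)).
  have uv : v = u.
    apply/esym/set1_inj; rewrite -(far_edge_meet u ij) -(far_edge_meet v ij').
    by have [[-> ->]|[-> ->]] := set2_eqP ef eE; rewrite // setIC.
  rewrite {v}uv in eE *.
  by have [[/far_edge_inj-> /far_edge_inj->]|[/far_edge_inj-> /far_edge_inj->]]
    := set2_eqP ef eE.
have H_inj : injective H.
  move=> c d Hcd; have [s_gt2 _ _ _] := sP c.
  case sE : (s c) s_gt2 => [//|e s'] _.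
  have He : [set e; next (s c) e] \in H c.
    by apply/imsetP; exists e => //; rewrite sE mem_head.
  by apply: (H_color _ _ _ He); rewrite -Hcd.
exists (H @: setT), #|C|; split.
- by left; rewrite cardC; apply: line_far_graph_regular.
- by rewrite card_imset // cardsT.
- by move=> _ /imsetP[c _ ->]; exists (s c); have [] := sP c.
- move=> _ _ /imsetP[c _ ->] /imsetP[d _ ->] Hcd; apply/pred0P=> x /=.
  apply/negP=> /andP[/H_color/[apply] cd]; by rewrite cd eqxx in Hcd.
Qed.

End OneFactorization.

(** * Zigzag Hamilton cycles on the index set *)

Section ZigZag.
Import GRing.Theory.
Local Open Scope ring_scope.

Variable m : nat.
Local Notation C := 'I_m.+3.
Local Notation K := 'I_m.+4.

Definition pair_sum (i j : option C) : C :=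
  match i, j with
  | Some a, Some b => a + b
  | Some a, None | None, Some a => a + a
  | None, None => 0
  end.

Lemma pair_sumC i j : pair_sum i j = pair_sum j i.
Proof. by case: i j => [a|] [b|] //=; rewrite addrC. Qed.

(** Walecki's sequence 0, 1, -1, 2, -2, ... *)
Definition zigzag (n : nat) : C := if odd n then (uphalf n)%:R else - n./2%:R.

Lemma ord_natr_eq0 n (d : nat) : (d%:R == 0 :> 'I_n.+2) = (n.+2 %| d)%N.
Proof. by rewrite -val_eqE /= Zp_nat. Qed.

Lemma zigzagS n : zigzag n + zigzag n.+1 = (~~ odd n)%:R.
Proof.
rewrite /zigzag /=; have [on|en] := boolP (odd n) => /=.
  by rewrite subrr.
by rewrite mulrSr addKr.
Qed.

(** Terms at an odd [a] and an even [b] differ by [(a + b + 1) / 2], strictly between 0 and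
    [m + 3]. *)
Lemma zigzag_inj n n' : (n < m.+3)%N -> (n' < m.+3)%N -> zigzag n = zigzag n' -> n = n'.
Proof.
suff H a b : (a < m.+3)%N -> (b < m.+3)%N -> odd a -> ~~ odd b -> zigzag a <> zigzag b.
  have E a b : (a <= b < m.+3)%N -> (a%:R = b%:R :> C) -> a = b.
    case/andP=> ab bm /eqP; rewrite eq_sym -subr_eq0 -natrB // ord_natr_eq0.
    move=> /dvdnP[[|x]]; nia.
  move=> nm n'm; case on: (odd n); case on': (odd n') => e.
  - move: e; rewrite /zigzag on on' => e.
    case: (leqP (uphalf n) (uphalf n')) => le.
      have := E (uphalf n) (uphalf n') _ e. lia.
    have := E (uphalf n') (uphalf n) _ (esym e). lia.
  - by case: (H n n'); rewrite ?on ?on'.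
  - by case: (H n' n); rewrite ?on ?on'.
  - move: e; rewrite /zigzag on on' => /oppr_inj e.
    case: (leqP (n./2) (n'./2)) => le.
      have := E (n./2) (n'./2) _ e. lia.
    have := E (n'./2) (n./2) _ (esym e). lia.
move=> am bm oa ob; rewrite /zigzag oa (negPf ob) => /eqP.
rewrite -subr_eq0 opprK -natrD ord_natr_eq0 => /dvdnP[[|x]]; nia.
Qed.

(** A pair with [None] is classed by twice its index, so this handles the edge closing the cycle. *)
Lemma zigzag_last : 2%:R * zigzag m.+2 = (~~ odd m)%:R.
Proof.
rewrite /zigzag /= negbK; case: ifP => om.
  rewrite -natrM; apply/eqP; rewrite ord_natr_eq0; apply/dvdnP; exists 1%N. lia.
apply/eqP; rewrite mulrN -natrM eq_sym -subr_eq0 opprK -natrD ord_natr_eq0.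
apply/dvdnP; exists 1%N. lia.
Qed.

(* With [c = 2h] or [c + 1 = 2h], according to the parity of the representative
   of [c], the cycle is None, h, h + 1, h - 1, h + 2, ... or its mirror image. For
   odd [m] both edges at [None] lie in the same class, whence the exception. *)
Lemma pair_sum_cycle (c : C) : exists (p : K -> option C) (t : K -> bool),
  [/\ p 0 = None, injective p,
      forall j, pair_sum (p j) (p (j + 1)) = c + (t j)%:R
    & forall j, j + 1 != 0 -> t (j + 1) = ~~ t j].
Proof.
have c_nat : c = (c : nat)%:R by rewrite natr_Zp.
pose h : C := (uphalf c)%:R.
(* For odd [c], [2h = c + 1], so the offsets 0 and 1 of zigzag sums must become 0 and -1. *)
pose sg (x : C) : C := if odd c then - x else x.
exists (fun j : K => if j == 0 then None else Some (h + sg (zigzag j.-1))).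
exists (fun j : K => odd c (+) odd j).
have sgI : injective sg by rewrite /sg; case: (odd c) => // x y /oppr_inj.
have succ (j : K) : (j + 1 = 0 /\ val j = m.+3) \/ val (j + 1) = (val j).+1.
  have [jm|jm] := eqVneq (nat_of_ord j) m.+3.
    by left; split=> //; apply/eqP; rewrite -val_eqE /= jm addn1 modnn.
  right; rewrite /= addn1 modn_small //.
  by move: jm (ltn_ord j); lia.
have h2 : h + h = c + (odd c)%:R.
  rewrite -natrD (_ : _ + _ = c + odd c)%N; last by lia.
  by rewrite natrD -c_nat.
split=> //.
- move=> i j; case: eqVneq => [->|i0]; case: eqVneq => [->|j0] //.
  move=> /Some_inj/addrI/sgI/zigzag_inj ij; apply: val_inj.
  move: i0 j0 ij; rewrite -!val_eqE /=.
  have := ltn_ord i; have := ltn_ord j; lia.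
- move=> j; have [[-> jm]|jS] := succ j.
    have j0 : j != 0 by rewrite -val_eqE /= jm.
    rewrite eqxx (negPf j0) jm /= negbK.
    set z := sg _; rewrite addrACA h2 -addrA; congr (_ + _).
    have -> : z + z = sg (~~ odd m)%:R.
      rewrite /z -zigzag_last /sg; case: ifP => _; ring.
    by rewrite /sg; case: (odd c); case: (odd m) => //=; ring.
  have j10 : j + 1 != 0 by rewrite -val_eqE jS.
  rewrite (negPf j10) jS; case: eqVneq => [->|j0] /=.
    rewrite /zigzag /= oppr0 /sg oppr0 if_same addr0 h2; by case: (odd c).
  case jn : (nat_of_ord j) => [|n]; first by rewrite -val_eqE /= jn in j0.
  rewrite addrACA h2 -addrA; congr (_ + _).
  have -> : sg (zigzag n.+1.-1) + sg (zigzag n.+1) = sg (~~ odd n)%:R.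
    rewrite /= -zigzagS /sg; case: ifP => _ //; ring.
  by rewrite /= /sg; case: (odd c); case: (odd n) => //=; ring.
- move=> j j10; have [[e _]|->] := succ j; first by rewrite e eqxx in j10.
  by rewrite /= addbN.
Qed.

End ZigZag.

(** Listed from [f0 a], the [f0]-orbit ends at [a], so [f] copies every step before its end. *)
Lemma fconnect_cut (T : finType) (f f0 : T -> T) (a : T) :
    injective f0 ->
    (forall y, fconnect f0 a y -> y != a -> f y = f0 y) ->
  forall y, fconnect f0 a y -> fconnect f (f0 a) y.
Proof.
move=> f0I ff0 y; rewrite (same_fconnect1 f0I a) => af0y.
rewrite -(iter_findex af0y).
have : findex f0 (f0 a) y < fingraph.order f0 (f0 a) by rewrite findex_max.
elim: (findex _ _ _) => [|r IHr] r_lt; first exact: connect0.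
apply: connect_trans (IHr (ltnW r_lt)) _.
rewrite iterS -[f0 (iter _ _ _)]ff0; first exact: fconnect1.
  by rewrite (same_fconnect1 f0I) fconnect_iter.
apply/eqP=> ra; have := findex_iter r_lt.
by rewrite iterS ra findex0.
Qed.

(** * The spliced graph and its decomposition *)

Section Spliced.
Import GRing.Theory.
Local Open Scope ring_scope.

Variables (m : nat) (Z : finZmodType).
Local Notation C := 'I_m.+3.
Local Notation K := 'I_m.+4.
Local Notation I := (option C).
Local Notation P := (option (C * Z)).

Variable g : I -> Z.
Hypotheses (g0 : g None = 0) (gI : injective g).
Hypothesis g_gen : forall (e : I -> bool) (x : Z),
  exists r, x = (\sum_i (if e i then g i else - g i)) *+ r.

Definition translate (z : Z) (w : P) : P := omap (fun ax => (ax.1, ax.2 + z)) w.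

Lemma translate_inj z : injective (translate z).
Proof. by move=> [[a x]|] [[b y]|] //= [-> /addIr->]. Qed.

Definition shift z : {perm P} := perm (@translate_inj z).

(* Edge [i] joins [(false, w)] to [(true, link i w)]. The vertices [(b, None)] are
   u and v, and [Some (a, x)] is the point [x] of gadget [a]. *)
Definition link (i : I) : {perm P} :=
  if i is Some a then (tperm None (Some (a, 0)) * shift (g i))%g else 1%g.

Lemma linkE a w : link (Some a) w =
  match w with
  | None => Some (a, g (Some a))
  | Some (b, x) => if (b == a) && (x == 0) then None else Some (b, x + g (Some a))
  end.
Proof.
rewrite permM permE; case: w => [[b x]|]; last by rewrite tpermL /= add0r.
case: tpermP => [//|[-> ->]|_ /eqP]; first by rewrite !eqxx.
by rewrite -[_ == _]/((b == a) && (x == 0)) => /negPf->.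
Qed.

Lemma link_inj w : injective (link^~ w).
Proof.
have H a x b : Some (b, x) = link (Some a) (Some (b, x)) -> False.
  rewrite linkE; case: ifP => // _ /Some_inj [] /(canLR (addKr x)).
  by rewrite addNr -g0 => /gI.
case=> [a|] [b|] //=.
- case: w => [[e x]|]; rewrite !linkE; last by case=> ->.
  case: ifP => [/andP[/eqP ea _]|_]; case: ifP => [/andP[/eqP eb _]|_] //.
    by rewrite -ea -eb.
  by case=> /addrI/gI.
- case: w => [[e x]|]; last by rewrite linkE perm1.
  by rewrite perm1 => /esym/H.
- case: w => [[e x]|]; last by rewrite linkE perm1.
  by rewrite perm1 => /H.
Qed.

Local Notation V := (bool * P)%type.

Definition cross (i : I) (u : V) : V :=
  (~~ u.1, (if u.1 then (link i)^-1 else link i)%g u.2).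

Lemma cross_inv i : involutive (cross i).
Proof. by case=> [[] w]; rewrite /cross /= ?permK ?permKV. Qed.

Lemma cross_neq i u : cross i u != u.
Proof. by case: u => [[] w]. Qed.

Lemma cross_inj u : injective (cross^~ u).
Proof.
case: u => [[] w] i j; rewrite /cross /= => -[]; last exact: link_inj.
set y := _ w => yE; apply: (@link_inj y).
by rewrite /= {2}yE /y !permKV.
Qed.

Definition spliced_graph := far_graph cross_inv cross_neq.

Section Colour.
Variables (p : K -> I) (t : K -> bool).
Hypotheses (p0 : p 0 = None) (pI : injective p).

(* A state [(j, w)] is the edge of index [p j] left through the vertex [(t j, w)]. *)
Definition rho (j : K) : {perm P} := if t j then link (p j) else (link (p j))^-1%g.
Definition step (s : K * P) : K * P := (s.1 + 1, rho (s.1 + 1) s.2).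

(* [step0] is [step] in the graph where no gadget has been cut open. *)
Definition signed_gain (j : K) : Z := if t j then g (p j) else - g (p j).
(** [rho j] sends this point of the gadget [p j] to [None]. *)
Definition port (j : K) : Z := if t j then 0 else g (p j).
Definition step0 (s : K * P) : K * P := (s.1 + 1, shift (signed_gain (s.1 + 1)) s.2).

Lemma shiftE z w : shift z w = translate z w.
Proof. by rewrite permE. Qed.

Lemma shiftV z : ((shift z)^-1 = shift (- z))%g.
Proof.
apply/eqP; rewrite eq_invg_mul; apply/eqP/permP=> w.
by rewrite permM !shiftE perm1; case: w => [[a x]|] //=; rewrite addrK.
Qed.

(** For an inverse link, conjugating the transposition by the shift moves the cut point from 0 to
    [g (p j)]. *)
Lemma rhoE j a : p j = Some a ->
  rho j = (tperm None (Some (a, port j)) * shift (signed_gain j))%g.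
Proof.
move=> pj; rewrite /rho /port /signed_gain /link pj; case: (t j) => //.
rewrite invMg tpermV conjgCV invgK tpermJ shiftV !shiftE /=.
by rewrite add0r.
Qed.

Lemma step_inj : injective step.
Proof.
move=> [j w] [j' w'] e; have /addIr/= jj' := congr1 fst e; have /= := congr1 snd e.
by rewrite jj' => /perm_inj->.
Qed.

Lemma step0_inj : injective step0.
Proof.
move=> [j w] [j' w'] e; have /addIr/= jj' := congr1 fst e; have /= := congr1 snd e.
by rewrite jj' => /perm_inj->.
Qed.


Lemma step0_iter r j a x : iter r step0 (j, Some (a, x)) =
  (j + r%:R, Some (a, x + \sum_(l < r) signed_gain (j + l.+1%:R))).
Proof.
elim: r => [|r IHr]; first by rewrite big_ord0 !addr0.
by rewrite iterS IHr /step0 /= shiftE big_ord_recr /= -(addrA j) -mulrSr addrA.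
Qed.

Lemma sum_signed_gain j : \sum_(l < m.+4) signed_gain (j + l.+1%:R) = \sum_l signed_gain l.
Proof.
rewrite [RHS](reindex_inj (addrI (j + 1))); apply: eq_bigr => l _.
by rewrite mulrS natr_Zp addrA.
Qed.

Lemma p_bij : bijective p.
Proof. by apply: inj_card_bij => //; rewrite card_option !card_ord. Qed.

Lemma sum_signed_gain_gen x : exists r, x = (\sum_l signed_gain l) *+ r.
Proof.
have [q pK qK] := p_bij.
have [r ->] := g_gen (t \o q) x; exists r; congr (_ *+ _).
rewrite (reindex p); last by apply: onW_bij; exact: p_bij.
by apply: eq_bigr => l _ /=; rewrite pK.
Qed.

(** Each full turn of the index cycle adds the total signed gain, which generates [Z]. *)
Lemma step0_connect j j' a x y : fconnect step0 (j, Some (a, x)) (j', Some (a, y)).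
Proof.
have [x' jj'] : exists x', fconnect step0 (j, Some (a, x)) (j', Some (a, x')).
  exists (x + \sum_(l < (j' - j)%R) signed_gain (j + l.+1%:R)).
  have := fconnect_iter step0 (j' - j)%R (j, Some (a, x)).
  by rewrite step0_iter natr_Zp addrC subrK.
apply: connect_trans jj' _.
have [r ->] : exists r, y = x' + (\sum_l signed_gain l) *+ r.
  by have [r rE] := sum_signed_gain_gen (y - x'); exists r; rewrite -rE addrC subrK.
elim: r => [|r IHr]; first by rewrite addr0 connect0.
apply: connect_trans IHr _.
set z := _ + _; have := fconnect_iter step0 m.+4 (j', Some (a, z)).
have k0 : m.+4%:R = 0 :> K by apply/eqP; rewrite ord_natr_eq0.
by rewrite step0_iter sum_signed_gain /z -addrA -mulrSr k0 addr0.
Qed.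

Lemma step_step0 j a x : x <> port (j + 1) \/ p (j + 1) <> Some a ->
  step (j, Some (a, x)) = step0 (j, Some (a, x)).
Proof.
move=> H; rewrite /step /step0 /=; congr pair; case pj : (p (j + 1)) H => [b|] H.
  rewrite (rhoE pj) permM tpermD //; apply/eqP=> -[ba xz].
  by case: H => [|[]]; rewrite ?ba // xz.
by rewrite shiftE /rho /signed_gain pj g0 oppr0 invg1 !if_same perm1 /= addr0.
Qed.

(** As [p] is injective, [s] is the only state of gadget [a] where [step] departs from [step0]. From
    [(j, None)] the walk enters just after [s] and follows the whole [step0] orbit up to [s]. *)
Lemma step_connect_gadget j a : p (j + 1) = Some a ->
  forall j' x, fconnect step (j, None) (j', Some (a, x)).
Proof.
move=> pj j' x; pose s := (j, Some (a, port (j + 1))).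
have e : step (j, None) = step0 s.
  by rewrite /step (rhoE pj) /= permM tpermL.
apply: connect_trans (fconnect1 _ _) _; rewrite e.
apply: fconnect_cut step0_inj _ _ (step0_connect _ _ _ _ _) => y.
move=> /iter_findex; rewrite step0_iter => <-.
move: (j + (findex _ _ _)%:R) (port _ + _) => l z lz; apply: step_step0.
have [lj|/eqP lj] := eqVneq l j; [left|right].
  by rewrite lj => zE; move: lz; rewrite lj zE eqxx.
by rewrite -pj => /pI/addIr.
Qed.

(** After touring the gadget [p (j + 1)], the walk leaves it from the port; with index [None] it
    steps directly. *)
Lemma step_connect_outer j : fconnect step (j, None) (j + 1, None).
Proof.
case pj : (p (j + 1)) => [a|].
  apply: connect_trans (step_connect_gadget pj j (port (j + 1))) _.
  apply: connect1; apply/eqP.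
  by rewrite /step /= (rhoE pj) permM tpermR shiftE.
apply: connect1; apply/eqP.
by rewrite /step /= /rho pj invg1 if_same perm1.
Qed.

Lemma step_connect s : fconnect step (0, None) s.
Proof.
have outer j : fconnect step (0, None) (j, None).
  rewrite -(natr_Zp j); elim: (val j) => [|r IHr]; first exact: connect0.
  by rewrite mulrSr; apply: connect_trans IHr (step_connect_outer _).
case: s => j [[a x]|//].
have [q _ qK] := p_bij.
apply: connect_trans (outer (q (Some a) - 1)) _.
by apply: step_connect_gadget; rewrite subrK qK.
Qed.

Definition walk_edge (s : K * P) : edge spliced_graph :=
  far_edge cross_inv cross_neq (p s.1) (t s.1, s.2).

(** The index of an edge fixes [j], and only one of its ends lies on side [t j]. *)
Lemma walk_edge_inj : injective walk_edge.
Proof.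
move=> [j w] [j' w']; rewrite /walk_edge /= => e.
have jw : (t j, w) \in val (far_edge cross_inv cross_neq (p j') (t j', w')).
  by rewrite -e set21.
have jj' : j = j'.
  by move: e; rewrite (far_edge_at jw) => /(far_edge_inj cross_inj)/pI.
by move: jw; rewrite jj' => /set2P[[->]|[]] //; case: (t j').
Qed.

Lemma walk_edge_surj e : exists s, e = walk_edge s.
Proof.
have [i [u ->]] := far_edgeP e; have [q _ qK] := p_bij.
have [ut|ut] := eqVneq u.1 (t (q i)).
  by exists (q i, u.2); rewrite /walk_edge /= qK -ut -surjective_pairing.
exists (q i, (cross i u).2); rewrite /walk_edge /= qK -[LHS]far_edge_far.
by congr far_edge; rewrite /cross /=; congr pair; case: u.1 (t _) ut => -[].
Qed.

Variable c : C.
Hypothesis sum_p : forall j, pair_sum (p j) (p (j + 1)) = c + (t j)%:R.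
Hypothesis t_alt : forall j, j + 1 != 0 -> t (j + 1) = ~~ t j.

(** Sides alternate except possibly on reaching the index [None]; there [link] is the identity, so
    both ends of the edge carry the same point. *)
Lemma walk_edge_step s :
  walk_edge (step s) = far_edge cross_inv cross_neq (p (s.1 + 1)) (t s.1, s.2).
Proof.
rewrite -[RHS]far_edge_far /walk_edge /step /rho /cross /=.
have [->|/t_alt->] := eqVneq (s.1 + 1) 0; last by case: (t _).
rewrite p0 invg1 !if_same perm1.
have [->//|] := eqVneq (t 0) (~~ t s.1).
rewrite -[in LHS]far_edge_far /cross /= invg1 if_same perm1.
by case: (t 0) (t s.1) => -[].
Qed.

Lemma spliced_cycle : exists s : seq (edge spliced_graph),
  [/\ (2 < size s)%N, ucycle (@adj (line_graph spliced_graph)) s, forall e, e \in s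
    & {in s, forall e, exists u i j,
        [/\ i != j, e = far_edge cross_inv cross_neq i u,
            next s e = far_edge cross_inv cross_neq j u
          & pair_sum i j - u.1%:R = c]}].
Proof.
pose o := fingraph.orbit step (0, None).
have o_mem s : s \in o by rewrite -fconnect_orbit step_connect.
have o_uniq : uniq o := orbit_uniq _ _.
have o_cycle : fcycle step o := cycle_orbit step_inj _.
have p_neq j : p j != p (j + 1).
  by rewrite (inj_eq pI) -[X in X == _]addr0 (inj_eq (addrI j)) eq_sym oner_eq0.
exists (map walk_edge o); split.
- have : {subset [:: (0, None); (1, None); (1, Some (0, 0))] <= o} by [].
  by rewrite size_map => /uniq_leq_size; apply.
- rewrite /ucycle map_inj_uniq ?o_uniq ?andbT; last exact: walk_edge_inj.
  rewrite cycle_map; apply: sub_cycle o_cycle => s _ /= /eqP<-.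
  rewrite walk_edge_step; apply: etrans (p_neq s.1); exact: far_edge_adj cross_inj _ _ _.
- by move=> e; have [s ->] := walk_edge_surj e; exact: map_f.
- move=> _ /mapP[s so ->]; exists (t s.1, s.2), (p s.1), (p (s.1 + 1)).
  split=> //; last by rewrite sum_p addrK.
  rewrite next_map //; last exact: walk_edge_inj.
  by rewrite -(eqP (next_cycle o_cycle so)) walk_edge_step.
Qed.

End Colour.
Lemma spliced_decomposition :
  exists D : {set {set {set line_graph spliced_graph}}}, hamilton_decomposition D.
Proof.
apply: (far_graph_decomposition cross_inj (kap := fun u i j => pair_sum i j - u.1%:R)).
- by rewrite card_option !card_ord.
- by move=> u i j; rewrite pair_sumC.
- move=> c; have [p [t [p0 pI sum_p t_alt]]] := pair_sum_cycle c.
  exact (spliced_cycle p0 pI sum_p t_alt).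
Qed.

(** * Non-Hamiltonicity *)

Definition inside (u : V) := u.2 != None.
Definition gadget (u : V) : C := if u.2 is Some (a, _) then a else 0.

Lemma adj_gadget (u v : spliced_graph) :
  inside u -> inside v -> adj u v -> gadget u = gadget v.
Proof.
have H i w w' : inside (true, w) -> inside (true, w') -> w' = link i w ->
    gadget (true, w) = gadget (true, w').
  case: i => [a|]; last by rewrite perm1 => _ _ ->.
  case: w w' => [[b x]|] [[b' x']|] // _ _; rewrite linkE /gadget /=.
  by case: ifP => // _ [].
case: u v => [b w] [b' w'] wi wi' /existsP[i /eqP[_]]; case: b wi => wi e.
  by apply: esym; apply: (H i) => //; rewrite e permKV.
exact: (H i).
Qed.

Lemma sorted_gadget (s : seq spliced_graph) : sorted (@adj spliced_graph) s ->
  all inside s -> exists a, {in s, forall u, gadget u = a}.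
Proof.
elim: s => [|u [|v s] IHs] /=; first by exists 0.
  by move=> _ _; exists (gadget u) => v; rewrite inE => /eqP->.
case/andP=> uv vs /and3P[ui vi si]; have [|a aP] := IHs vs; first by rewrite /= vi.
exists a => w; rewrite inE => /orP[/eqP->|/aP//].
by rewrite (adj_gadget ui vi uv) aP ?mem_head.
Qed.

(** Cutting a Hamilton cycle at the two outer vertices leaves two paths, each within one gadget, but
    there are [m + 3] gadgets. *)
Lemma spliced_not_hamiltonian : ~ hamiltonian spliced_graph.
Proof.
case=> _ [s [_ s_cycle s_all _]].
have [i s' s_rot] := rot_to (s_all (false, None)).
have := s_all (true, None); have := s_cycle.
rewrite -(rot_ucycle i) -(mem_rot i) s_rot => /andP[/= s_path s_uniq].
rewrite inE /= => s'_true; case/splitPr: s'_true s_rot s_path s_uniq => s1 s2 s_rot.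
rewrite rcons_cat rcons_cons cat_path /= rcons_path => /and3P[p1 _ /andP[p2 _]].
rewrite mem_cat inE cat_uniq /= !negb_or.
case/andP=> /andP[u1 u2] /and4P[_ /andP[v1 _] v2 _].
have inP (r : seq V) : (false, None) \notin r -> (true, None) \notin r -> all inside r.
  move=> u_r v_r; apply/allP=> -[b [//|]] b_r.
  by case: b b_r u_r v_r => -> //.
have [a1 a1P] := sorted_gadget (path_sorted p1) (inP _ u1 v1).
have [a2 a2P] := sorted_gadget (path_sorted p2) (inP _ u2 v2).
have [a] : exists a, a \in ~: [set a1; a2].
  apply/set0Pn; rewrite -card_gt0 cardsCs setCK card_ord cards2 subn_gt0.
  by case: (_ != _).
rewrite !inE negb_or => /andP[aa1 aa2].
have := s_all (false, Some (a, 0)); rewrite -(mem_rot i) s_rot inE mem_cat inE /=.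
by case/orP=> [/a1P|/a2P] e; move: aa1 aa2; rewrite -e eqxx.
Qed.

End Spliced.

(** * Gains in a cyclic group of order a power of 2 *)

Section Gains.
Import GRing.Theory.
Local Open Scope ring_scope.

Lemma unipotent_inv (R : comNzRingType) (x : R) n : x ^+ n = 0 -> exists y, (1 + x) * y = 1.
Proof.
move=> xn; exists (\sum_(i < n) (- x) ^+ i); apply: oppr_inj.
by rewrite -mulNr opprD addrC -subrX1 exprNn xn mulr0 sub0r.
Qed.

(** Multiples of 2 are nilpotent here, so [s] is a unit, and a unit generates the additive group. *)
Lemma pow2_Zp_generator N (s t : 'Z_(2 ^ N.+1)) :
  s = 1 + 2%:R * t \/ s = - 1 + 2%:R * t -> forall x, exists r, x = s *+ r.
Proof.
have n_gt1 : (1 < 2 ^ N.+1)%N by rewrite -{1}(expn0 2) ltn_exp2l.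
have unip (t' : 'Z_(2 ^ N.+1)) : exists y, (1 + 2%:R * t') * y = 1.
  by apply: (unipotent_inv (n := N.+1)); rewrite exprMn -natrX pchar_Zp // mul0r.
have gen (y : 'Z_(2 ^ N.+1)) : s * y = 1 -> forall x, exists r, x = s *+ r.
  move=> sy x; exists (val (y * x)).
  by rewrite -mulr_natr natr_Zp mulrA sy mul1r.
case=> sE; first by have [y yP] := unip t; apply: (gen y); rewrite sE.
have [y yP] := unip (- t); apply: (gen (- y)).
by rewrite -yP sE; ring.
Qed.

Variable m : nat.
Local Notation Z := 'Z_(2 ^ m.+4).

(** The values are 0, 1, 2, 4, ..., [2(m + 2)], with 1 the only odd one. *)
Definition nat_gain (i : option 'I_m.+3) : nat :=
  if i is Some a then if a == 0 then 1%N else (2 * a)%N else 0%N.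

Lemma nat_gain_inj : injective nat_gain.
Proof.
have a0 (a : 'I_m.+3) : (a == 0) = (nat_of_ord a == 0%N) by [].
case=> [a|] [b|] //=; rewrite !a0.
- by move=> ab; congr Some; apply: val_inj; move: ab; case: eqP; case: eqP => /=; lia.
- by case: eqP => //; lia.
- by case: eqP => //; lia.
Qed.

Definition gain (i : option 'I_m.+3) : Z := (nat_gain i)%:R.

Lemma gain_inj : injective gain.
Proof.
(* The modulus exceeds every gain, so reduction keeps them distinct. *)
have n_gt : (2 * m.+3 < 2 ^ m.+4)%N by rewrite expnS ltn_mul2l ltn_expl.
have lt i : (nat_gain i < 2 ^ m.+4)%N.
  apply: leq_ltn_trans n_gt; rewrite /nat_gain; case: i => // a.
  by case: ifP => // _; have := ltn_ord a; lia.
move=> i j /(congr1 val)/=; rewrite !val_Zp_nat ?(leq_trans _ n_gt) // !modn_small //.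
exact: nat_gain_inj.
Qed.

(** Whatever the signs, the odd gain gives 1 or -1 and the others an even total. *)
Lemma gain_gen (e : option 'I_m.+3 -> bool) (x : Z) :
  exists r, x = (\sum_i (if e i then gain i else - gain i)) *+ r.
Proof.
rewrite (bigD1 (Some 0)) //=.
have [t ->] : exists t : Z, \sum_(i | i != Some 0) (if e i then gain i else - gain i) = 2%:R * t.
  apply: (big_ind (fun z => exists t : Z, z = 2%:R * t)).
  - by exists 0; rewrite mulr0.
  - by move=> _ _ [t1 ->] [t2 ->]; exists (t1 + t2); rewrite mulrDr.
  - move=> [a|] i0; last by exists 0; rewrite oppr0 if_same mulr0.
    exists (if e (Some a) then (a : nat)%:R else - (a : nat)%:R).
    have a0 : a != 0 by apply: contraNneq i0 => ->.
    by rewrite /gain /= (negPf a0) natrM; case: (e _); rewrite ?mulrN.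
apply: (@pow2_Zp_generator m.+3 _ t); rewrite /gain /=.
by case: (e _); [left | right].
Qed.

End Gains.

Theorem theorem5 (k : nat) (hk : 4 <= k) :
  exists Y : sgraph, [/\ 0 < #|Y|, regular Y k, ~ hamiltonian Y &
    exists D : {set {set {set line_graph Y}}}, hamilton_decomposition D].
Proof.
(* With [k = m + 4] there are [k] indices and [k - 1] gadgets. *)
rewrite -(subnKC hk) add4n; move: (k - 4) => m.
have g0 : gain None = 0%R :> 'Z_(2 ^ m.+4) by [].
exists (spliced_graph (@gain m)); split.
- by apply/card_gt0P; exists (false, None).
- move=> u; apply: etrans (far_graph_regular (cross_inj g0 (@gain_inj m)) u) _.
  by rewrite card_option card_ord.
- exact: spliced_not_hamiltonian.
- exact: spliced_decomposition g0 (@gain_inj m) (@gain_gen m).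
Qed.
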